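(* Let $m,n$ be nonzero integers and let $B(m,n)=\langle a,b : a^{-1}b^m a=b^n\rangle$ be the Baumslag–Solitar group. (1) If $|m|\neq |n|$, then for every injective endomorphism $\phi$ of $B(m,n)$ the Reidemeister number $R(\phi)$ is infinite. (2) If $|m|=|n|$ and $mn\neq 1$, then for every automorphism $\phi$ of $B(m,n)$ the Reidemeister number $R(\phi)$ is infinite.
   Context: For a group $G$ and an endomorphism $\phi:G\to G$, two elements $\alpha,\alpha'\in G$ are called $\phi$-conjugate if there is $\gamma\in G$ with $\alpha'=\gamma\alpha\phi(\gamma)^{-1}$. This is an equivalence relation on $G$; the Reidemeister number $R(\phi)$ is the number (cardinality) of its equivalence classes. *)

(* Defs.v *)
From HB Require Import structures.
From mathcomp Require Import all_boot all_order all_algebra.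
From mathcomp Require Import boolp classical_sets cardinality.

Set Implicit Arguments.
Unset Strict Implicit.
Unset Printing Implicit Defensive.

Local Open Scope group_scope.
Local Open Scope classical_set_scope.
Local Open Scope quotient_scope.

(* The letter (x, false) stands for the generator x, and (x, true) for its
   formal inverse. *)
Definition word (X : choiceType) : Type := seq (X * bool).
HB.instance Definition _ (X : choiceType) := Choice.on (word X).

Definition invl (X : choiceType) (l : X * bool) : X * bool := (l.1, ~~ l.2).

Definition invw (X : choiceType) (w : word X) : word X :=
  rev [seq invl l | l <- w].

Definition expw (X : choiceType) (x : X) (k : int) : word X :=
  match k with
  | Posz i => nseq i (x, false)
  | Negz i => nseq i.+1 (x, true)
  end.

(* The congruence on words defining < X : u = v for all (u, v) in rels >. *)
Inductive pres_eq (X : choiceType) (rels : word X -> word X -> Prop) :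
    word X -> word X -> Prop :=
  | pres_refl u : pres_eq rels u u
  | pres_sym u v : pres_eq rels u v -> pres_eq rels v u
  | pres_trans v u w : pres_eq rels u v -> pres_eq rels v w -> pres_eq rels u w
  | pres_cat u u' v v' : pres_eq rels u u' -> pres_eq rels v v' ->
      pres_eq rels (u ++ v) (u' ++ v')
  | pres_cancel l : pres_eq rels [:: l; invl l] [::]
  | pres_rel u v : rels u v -> pres_eq rels u v.

Section Presentation.
Variables (X : choiceType) (rels : word X -> word X -> Prop).

Definition pres_eqb : rel (word X) := fun u v => `[< pres_eq rels u v >].

Lemma pres_eqb_refl : reflexive pres_eqb.
Proof. by move=> u; apply/asboolP; exact: pres_refl. Qed.

Lemma pres_eqb_sym : symmetric pres_eqb.
Proof. by move=> u v; apply/asboolP/asboolP; exact: pres_sym. Qed.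

Lemma pres_eqb_trans : transitive pres_eqb.
Proof.
by move=> v u w /asboolP uv /asboolP vw; apply/asboolP; exact: pres_trans vw.
Qed.

Canonical pres_equiv :=
  EquivRel pres_eqb pres_eqb_refl pres_eqb_sym pres_eqb_trans.

Definition presented : Type := {eq_quot pres_equiv}.
HB.instance Definition _ := Choice.on presented.

Definition pres_class (w : word X) : presented := \pi_{eq_quot pres_equiv} w.

Lemma pres_classP u v : pres_class u = pres_class v <-> pres_eq rels u v.
Proof. by split=> [/eqquotP/asboolP | uv] //; apply/eqquotP/asboolP. Qed.

Definition pres_repr (g : presented) : word X :=
  repr (g : {eq_quot pres_equiv}).

Lemma pres_reprK : cancel pres_repr pres_class.
Proof. by move=> g; exact: reprK. Qed.

Definition pres_mul (g h : presented) : presented :=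
  pres_class (pres_repr g ++ pres_repr h).

Definition pres_one : presented := pres_class [::].

Definition pres_inv (g : presented) : presented :=
  pres_class (invw (pres_repr g)).

Lemma pres_repr_class u : pres_eq rels (pres_repr (pres_class u)) u.
Proof. by apply/pres_classP; rewrite pres_reprK. Qed.

Lemma pres_mulE u v :
  pres_mul (pres_class u) (pres_class v) = pres_class (u ++ v).
Proof. by apply/pres_classP; apply: pres_cat; exact: pres_repr_class. Qed.

Lemma invlK : involutive (@invl X).
Proof. by case=> x b; rewrite /invl /= negbK. Qed.

Lemma pres_mulVw w : pres_eq rels (invw w ++ w) [::].
Proof.
elim: w => [|l w IHw]; first exact: pres_refl.
rewrite /invw /= rev_cons cat_rcons -/(invw w).
apply: pres_trans IHw.
apply: pres_cat; first exact: pres_refl.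
rewrite -[l :: w]/([:: l] ++ w) -[_ :: _ ++ w]/([:: invl l; l] ++ w).
rewrite -[X in pres_eq _ _ X]cat0s; apply: pres_cat; last exact: pres_refl.
by rewrite -{2}[l]invlK; exact: pres_cancel.
Qed.

Lemma invwK : involutive (@invw X).
Proof.
move=> w; rewrite /invw map_rev revK -map_comp.
by rewrite (eq_map (g := id)) ?map_id // => l /=; rewrite invlK.
Qed.

Lemma pres_mulwV w : pres_eq rels (w ++ invw w) [::].
Proof. by rewrite -{1}[w]invwK; exact: pres_mulVw. Qed.

Lemma pres_mulA : associative pres_mul.
Proof.
move=> g h k; rewrite -[g]pres_reprK -[h]pres_reprK -[k]pres_reprK.
by rewrite !pres_mulE catA.
Qed.

Lemma pres_mul1 : left_id pres_one pres_mul.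
Proof. by move=> g; rewrite -[g]pres_reprK pres_mulE. Qed.

Lemma pres_mulg1 : right_id pres_one pres_mul.
Proof. by move=> g; rewrite -[g]pres_reprK pres_mulE cats0. Qed.

Lemma pres_mulV : left_inverse pres_one pres_inv pres_mul.
Proof.
move=> g; rewrite -{2}[g]pres_reprK pres_mulE.
by apply/pres_classP; exact: pres_mulVw.
Qed.

Lemma pres_mulgV : right_inverse pres_one pres_inv pres_mul.
Proof.
move=> g; rewrite -{1}[g]pres_reprK pres_mulE.
by apply/pres_classP; exact: pres_mulwV.
Qed.

HB.instance Definition _ := isGroup.Build presented
  pres_mulA pres_mul1 pres_mulg1 pres_mulV pres_mulgV.

Definition pres_gen (x : X) : presented := pres_class [:: (x, false)].

End Presentation.

(* Generators: true is a, false is b. *)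
Definition BS_word_a (k : int) : word bool := expw true k.
Definition BS_word_b (k : int) : word bool := expw false k.

Definition BS_rels (m n : int) (u v : word bool) : Prop :=
  u = BS_word_a (-1)%R ++ BS_word_b m ++ BS_word_a 1 /\ v = BS_word_b n.

Definition BS (m n : int) : Type := presented (BS_rels m n).
HB.instance Definition _ (m n : int) := Group.on (BS m n).

Definition twisted_conj (G : groupType) (phi : G -> G) (x x' : G) : Prop :=
  exists g : G, x' = g * x * (phi g)^-1.

Definition reidemeister_classes (G : groupType) (phi : G -> G) : set (set G) :=
  [set [set x' | twisted_conj phi x x'] | x in [set: G]].

(* R(phi) is the cardinality of the set of phi-conjugacy classes. *)
Definition reidemeister_infinite (G : groupType) (phi : G -> G) : Prop :=
  infinite_set (reidemeister_classes phi).

Lemma twisted_conj_refl (G : groupType) (phi : UMagmaMorphism.type G G) x :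
  twisted_conj phi x x.
Proof. by exists 1; rewrite gmulf1 invg1 mul1g mulg1. Qed.

Lemma twisted_conj_sym (G : groupType) (phi : UMagmaMorphism.type G G) x y :
  twisted_conj phi x y -> twisted_conj phi y x.
Proof.
case=> g ->; exists g^-1.
by rewrite gmulfV invgK !mulgA mulVg mul1g -mulgA mulVg mulg1.
Qed.

Lemma twisted_conj_trans (G : groupType) (phi : UMagmaMorphism.type G G) x y z :
  twisted_conj phi x y -> twisted_conj phi y z -> twisted_conj phi x z.
Proof.
by case=> g -> [h ->]; exists (h * g); rewrite gmulfM invgM !mulgA.
Qed.

Lemma pres_invE (X : choiceType) (rels : word X -> word X -> Prop) (x : X) :
  (pres_gen rels x)^-1 = pres_class rels [:: (x, true)].
Proof.
apply: (mulIg (pres_gen rels x)); rewrite mulVg [RHS]pres_mulE.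
by apply/pres_classP/pres_sym; exact: (pres_cancel rels (x, true)).
Qed.

Section Universal.
Variables (X : choiceType) (H : groupType) (f : X -> H).

Definition evall (l : X * bool) : H := if l.2 then (f l.1)^-1 else f l.1.
Definition evalw (w : word X) : H := foldr (fun l h => evall l * h) 1 w.

Lemma evalw_cat u v : evalw (u ++ v) = evalw u * evalw v.
Proof. by elim: u => [|l u IHu] /=; rewrite ?mul1g // IHu mulgA. Qed.

Variable rels : word X -> word X -> Prop.
Hypothesis f_rels : forall u v, rels u v -> evalw u = evalw v.

Lemma evalw_pres u v : pres_eq rels u v -> evalw u = evalw v.
Proof.
elim=> {u v} // [v u w _ -> _ -> // | u u' v v' _ eu _ ev | [x b]].
  by rewrite !evalw_cat eu ev.
by case: b; rewrite /= /evall /= mulg1 ?mulgV ?mulVg.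
Qed.

Lemma presented_universal :
  exists! psi : presented rels -> H,
    {morph psi : g h / g * h} /\ forall x, psi (pres_gen rels x) = f x.
Proof.
have ev u : evalw (pres_repr (pres_class rels u)) = evalw u.
  by apply: evalw_pres; exact: pres_repr_class.
exists (evalw \o @pres_repr _ rels); split; first split.
- by move=> g h; rewrite /= ev evalw_cat.
- by move=> x; rewrite /= ev /= mulg1.
move=> psi [psiM psi_gen]; apply/funext => g /=; rewrite -[in RHS](pres_reprK g).
have psi1 : psi 1 = 1.
  by apply: (mulgI (psi 1)); rewrite -psiM !mulg1.
have psiV x : psi (x^-1) = (psi x)^-1.
  by apply: (mulgI (psi x)); rewrite -psiM !mulgV psi1.
elim: (pres_repr g) => [|[x b] w IHw] /=; first by rewrite -psi1.
rewrite -[(x, b) :: w]cat1s -pres_mulE [RHS]psiM -IHw; congr (_ * _).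
by case: b; rewrite /evall /= -psi_gen // -psiV pres_invE.
Qed.

End Universal.

Lemma pres_expwE (X : choiceType) (rels : word X -> word X -> Prop) x k :
  pres_class rels (expw x k) =
  match k with
  | Posz i => pres_gen rels x ^+ i
  | Negz i => pres_gen rels x ^- i.+1
  end.
Proof.
have nseqE b i :
    pres_class rels (nseq i (x, b)) = pres_class rels [:: (x, b)] ^+ i.
  by elim: i => [|i IHi] //=; rewrite expgS -IHi; exact/esym/pres_mulE.
by case: k => i; rewrite nseqE // -pres_invE expVgn.
Qed.

Lemma BS_relation (m n : int) (a := pres_gen (BS_rels m n) true) :
  a^-1 * pres_class _ (BS_word_b m) * a = pres_class _ (BS_word_b n).
Proof.
rewrite /a pres_invE [X in X * _]pres_mulE [LHS]pres_mulE -catA.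
by apply/pres_classP/pres_rel.
Qed.

(* Main.v *)
(** Let t : B(m, n) -> Z be the exponent sum of a ([BSwt] below). If b acts on a
    ring K as x |-> x + 1 and a as x |-> lam * x with m = lam * n in K, then the
    translation parts give a cocycle d : B(m, n) -> K with respect to lam ^ t
    ([BStr] below). Write k for t (phi a). Whenever t (phi b) = 0 and k = 1, the map t is constant on
    phi-conjugacy classes, so that the powers of a lie in distinct classes.

    If |m| <> |n|, then t (phi b) = 0 because b has finite order in the
    abelianization. As (phi b)^m and (phi b)^n are conjugate, phi b cannot be
    hyperbolic on the Bass-Serre tree, hence it is conjugate to a power of b,
    nontrivial because phi is injective, and d (phi b) <> 0 for K = Q, lam = m / n. Applying d to the defining relation
    then gives lam ^ k = lam, so k = 1.

    If m = eps * n with eps = 1 or -1 and phi is bijective, then k = 1 or -1. For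
    k = -1, on ker t the cocycle d with K = Z, lam = eps satisfies
    d (phi g) = c * d g with c = 1 or -1. If c = 1 the elements b^i are pairwise
    inequivalent, and if c = eps = -1 the elements b^i * a are. There remains
    B(m, m) with c = -1: choose a prime p dividing m and map onto the lamplighter
    group with K = F_p(X), lam = X. There phi acts on ker t as
    f |-> u * f(1/X) for an invertible Laurent polynomial u = -X^s, so
    u * u(1/X) = 1, and equivalence of a^i b a^-i and a^j b a^-j with i <> j
    forces u = X^(i + j). *)

Require Import Defs.
From HB Require Import structures.
From mathcomp Require Import all_boot all_order all_algebra.
From mathcomp Require Import boolp classical_sets cardinality.
From mathcomp Require Import zify ring.

Set Implicit Arguments.
Unset Strict Implicit.
Unset Printing Implicit Defensive.

Import Order.TTheory GRing.Theory Num.Theory.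
Local Open Scope ring_scope.

(** * Integer powers in a group *)

Section IntegerPowers.
Variable G : groupType.
Implicit Types (x y : G) (j k : int).

Definition expgz x k : G :=
  match k with Posz i => (x ^+ i)%g | Negz i => (x ^- i.+1)%g end.

Lemma expgz1 x : expgz x 1 = x.
Proof. by []. Qed.

Lemma expgzD1 x k : expgz x (k + 1) = (expgz x k * x)%g.
Proof.
case: k => [i|i]; first by rewrite -PoszD addn1 /= expgSr.
rewrite NegzE [- _ + 1](_ : _ = - i%:Z); last by lia.
by case: i => [|i]; rewrite /= ?mulVg // [in RHS]expgS invgM mulgVK.
Qed.

Lemma expgzB1 x k : expgz x (k - 1) = (expgz x k * x^-1)%g.
Proof. by apply: (mulIg x); rewrite -expgzD1 subrK mulgVK. Qed.

Lemma expgzD x j k : expgz x (j + k) = (expgz x j * expgz x k)%g.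
Proof.
elim/int_rect: k => [|i IH|i IH]; first by rewrite addr0 mulg1.
  by rewrite -addn1 PoszD addrA !expgzD1 IH mulgA.
by rewrite -addn1 PoszD opprD addrA !expgzB1 IH mulgA.
Qed.

Lemma expgzN x k : expgz x (- k) = (expgz x k)^-1%g.
Proof. by apply: (mulgI (expgz x k)); rewrite -expgzD subrr mulgV. Qed.

Lemma expgzM x j k : expgz x (j * k) = expgz (expgz x j) k.
Proof.
elim/int_rect: k => [|i IH|i IH]; first by rewrite mulr0.
  by rewrite -addn1 PoszD mulrDr mulr1 !(expgzD, IH).
by rewrite -addn1 PoszD opprD mulrDr mulrN1 !(expgzD, IH) !expgzN.
Qed.

Lemma expgz_conj x y k : expgz (y^-1 * x * y)%g k = (y^-1 * expgz x k * y)%g.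
Proof.
elim/int_rect: k => [|i IH|i IH]; first by rewrite mulg1 mulVg.
  by rewrite -addn1 PoszD !expgzD1 IH !mulgA mulgK.
by rewrite -addn1 PoszD opprD !expgzB1 IH !invgM invgK !mulgA mulgK.
Qed.

End IntegerPowers.

Lemma gmulf_expgz (G H : groupType) (phi : UMagmaMorphism.type G H) x k :
  phi (expgz x k) = expgz (phi x) k.
Proof. by case: k => i; rewrite /= ?gmulfV gmulfXn. Qed.

(** * Reidemeister classes *)

Lemma reidemeister_infinite_seq (G : groupType)
    (phi : UMagmaMorphism.type G G) (f : nat -> G) :
  (forall i j, twisted_conj phi (f i) (f j) -> i = j) ->
  reidemeister_infinite phi.
Proof.
move=> f_inj; apply/infiniteP/pcard_leP/injfunPex.
exists (fun i => [set x | twisted_conj phi (f i) x]%classic).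
  by move=> i _; exists (f i).
move=> i j _ _ /= eq_ij; apply: f_inj.
have : [set x | twisted_conj phi (f j) x]%classic (f j) by exact: twisted_conj_refl.
by rewrite -eq_ij.
Qed.

(** * Cocycles on words *)

Definition letter_wt (l : bool * bool) : int :=
  if l.1 then (if l.2 then -1 else 1) else 0.

Definition word_wt (w : word bool) : int := \sum_(l <- w) letter_wt l.

Lemma word_wt_cons l w : word_wt (l :: w) = letter_wt l + word_wt w.
Proof. exact: big_cons. Qed.

Lemma word_wt_cat v w : word_wt (v ++ w) = word_wt v + word_wt w.
Proof. exact: big_cat. Qed.

Section WordCocycle.
Variables (K : comUnitRingType) (lam : K).
Hypothesis lam_unit : lam \is a GRing.unit.
Variables (u v : K).

Definition letter_cocycle (l : bool * bool) : K :=
  let c := if l.1 then v else u in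
  if l.2 then - (lam ^ letter_wt l * c) else c.

(* The crossed homomorphism from the free group on a, b, where w acts on K as
   multiplication by lam ^ word_wt w, that maps b to u and a to v. *)
Fixpoint word_cocycle (w : word bool) : K :=
  if w is l :: w' then letter_cocycle l + lam ^ letter_wt l * word_cocycle w'
  else 0.

Lemma word_cocycle_cat w w' :
  word_cocycle (w ++ w') = word_cocycle w + lam ^ word_wt w * word_cocycle w'.
Proof.
elim: w => [|l w IHw] /=; first by rewrite /word_wt big_nil expr0z mul1r add0r.
by rewrite IHw word_wt_cons exprzDr // mulrDr !addrA mulrA.
Qed.

Lemma word_cocycle_cancel l : word_cocycle [:: l; invl l] = 0.
Proof.
case: l => [[] []]; rewrite /= /letter_cocycle /invl /letter_wt /= !mulr0 !addr0;
  rewrite ?expr0z ?mul1r ?addNr ?subrr // ?expr1z ?addNr //.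
by rewrite mulrN mulrA mulrV // mul1r subrr.
Qed.

End WordCocycle.

Lemma word_wt_expb k : word_wt (expw false k) = 0.
Proof.
have nseqb b i : word_wt (nseq i (false, b)) = 0.
  by elim: i => [|i IHi]; rewrite ?word_wt_cons ?IHi // /word_wt big_nil.
by case: k => i; exact: nseqb.
Qed.


Section WordCocycleTheory.
Variables (K : comUnitRingType) (lam : K).
Hypothesis lam_unit : lam \is a GRing.unit.

Lemma word_cocycle_expb u v k :
  word_cocycle lam u v (expw false k) = k%:~R * u.
Proof.
have pos b i : word_cocycle lam u v (nseq i (false, b)) = (-1) ^+ b * i%:R * u.
  elim: i => [|i IHi] /=; first by rewrite mulr0 mul0r.
  rewrite {}IHi /letter_cocycle /letter_wt /= expr0z !mul1r.
  by case: b; rewrite /= ?expr1 ?expr0 -natr1; ring.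
case: k => i; rewrite [word_cocycle _ _ _ _]pos ?expr0 ?mul1r //.
by rewrite NegzE mulrNz expr1 mulN1r.
Qed.

(** The two coefficients are the Fox derivatives of w with respect to b and a, evaluated at b = 1
    and a = [lam]. *)
Lemma word_cocycleD u v w :
  word_cocycle lam u v w =
  u * word_cocycle lam 1 0 w + v * word_cocycle lam 0 1 w.
Proof.
elim: w => [|[[] []] w IHw] /=; rewrite ?mulr0 ?addr0 // {}IHw;
  by rewrite /letter_cocycle /=; ring.
Qed.

End WordCocycleTheory.

(** With u = 0 the cocycle depends on the weight t alone: it is v (lam^t - 1) / (lam - 1), or v t
    when lam = 1. *)
Lemma word_cocycle_wt0 (K : idomainType) (lam v : K) w :
  lam \is a GRing.unit -> word_wt w = 0 -> word_cocycle lam 0 v w = 0.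
Proof.
move=> lam_unit w0; rewrite word_cocycleD mul0r add0r.
suff -> : word_cocycle lam 0 1 w = 0 by rewrite mulr0.
have [lam1|lam_n1] := eqVneq lam 1.
  transitivity ((word_wt w)%:~R : K); last by rewrite w0.
  rewrite lam1; elim: w {w0} => [|[[] []] w IHw];
    rewrite ?word_wt_cons /word_wt ?big_nil //=;
  by rewrite IHw /letter_cocycle /letter_wt /= exp1rz intrD; ring.
have : (lam - 1) * word_cocycle lam 0 1 w = lam ^ word_wt w - 1.
  elim: w {w0} => [|l w IHw].
    by rewrite /word_wt big_nil expr0z /= mulr0 subrr.
  rewrite /= mulrDr mulrCA IHw word_wt_cons exprzDr // mulrBr mulr1.
  case: l => [[] []]; rewrite /letter_cocycle /letter_wt /= ?expr0z ?expr1z.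
  - by rewrite mulr1 mulrN mulrBl mulrV // mul1r; ring.
  - by ring.
  - by ring.
  - by ring.
by rewrite w0 expr0z subrr => /eqP; rewrite mulf_eq0 subr_eq0 (negPf lam_n1) => /eqP.
Qed.

Lemma rmorph_word_cocycle (K L : comUnitRingType) (f : {rmorphism K -> L})
    (lam u v : K) w :
  lam \is a GRing.unit ->
  f (word_cocycle lam u v w) = word_cocycle (f lam) (f u) (f v) w.
Proof.
move=> lam_unit; elim: w => [|l w IHw] /=; first by rewrite rmorph0.
rewrite rmorphD rmorphM IHw rmorphXz //; congr (_ + _).
by case: l => [[] []]; rewrite /letter_cocycle /= ?rmorphN ?rmorphM ?rmorphXz.
Qed.

(** * The height and translation cocycles of B(m, n) *)

Section BaumslagSolitar.
Variables m n : int.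
Notation B := (BS m n).
Notation cl := (pres_class (BS_rels m n)).

Definition BSa : B := pres_gen (BS_rels m n) true.
Definition BSb : B := pres_gen (BS_rels m n) false.

Lemma BS_clM u v : cl (u ++ v) = (cl u * cl v : B)%g.
Proof. exact/esym/pres_mulE. Qed.

Lemma BS_clX x k : cl (expw x k) = expgz (pres_gen (BS_rels m n) x : B) k.
Proof. exact: pres_expwE. Qed.

Lemma BS_relation_expgz : (BSa^-1 * expgz BSb m * BSa)%g = expgz BSb n.
Proof. by rewrite -[expgz _ m]BS_clX -[expgz _ n]BS_clX; exact: BS_relation. Qed.

Definition BSwt (g : B) : int := word_wt (pres_repr g).

Lemma BSwt_cl w : BSwt (cl w) = word_wt w.
Proof.
rewrite /BSwt; move: (pres_repr_class (BS_rels m n) w).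
suff inv u v : pres_eq (BS_rels m n) u v -> word_wt u = word_wt v by exact: inv.
elim=> {u v w} // [v u w _ -> _ -> // | u u' v v' _ eu _ ev | l | u v [-> ->]].
- by rewrite !word_wt_cat eu ev.
- by case: l => [[] []]; rewrite /word_wt !big_cons !big_nil.
by rewrite !word_wt_cat !word_wt_expb /word_wt /= !big_cons !big_nil.
Qed.

Lemma BSwtM g h : BSwt (g * h)%g = BSwt g + BSwt h.
Proof.
rewrite -[g]pres_reprK -[h]pres_reprK -[(_ * _)%g]BS_clM.
by rewrite !BSwt_cl word_wt_cat.
Qed.

Lemma BSwt1 : BSwt 1%g = 0.
Proof. by apply: (addrI (BSwt 1%g)); rewrite -BSwtM mulg1 addr0. Qed.

Lemma BSwtV g : BSwt g^-1%g = - BSwt g.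
Proof. by apply: (addrI (BSwt g)); rewrite -BSwtM mulgV subrr BSwt1. Qed.

Lemma BSwtX g k : BSwt (expgz g k) = BSwt g * k.
Proof.
elim/int_rect: k => [|i IH|i IH]; first by rewrite BSwt1 mulr0.
  by rewrite -addn1 PoszD expgzD1 BSwtM IH mulrDr mulr1.
by rewrite -addn1 PoszD opprD expgzB1 BSwtM BSwtV IH mulrDr mulrN1.
Qed.

Lemma BSwt_a : BSwt BSa = 1.
Proof. by rewrite BSwt_cl /word_wt big_seq1. Qed.

Lemma BSwt_b : BSwt BSb = 0.
Proof. by rewrite BSwt_cl /word_wt big_seq1. Qed.

Section Translation.
Variables (K : comUnitRingType) (lam : K).
Hypothesis lam_unit : lam \is a GRing.unit.
Hypothesis lam_mn : m%:~R = lam * n%:~R.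

Definition BStr (g : B) : K := word_cocycle lam 1 0 (pres_repr g).

Lemma BStr_cl w : BStr (cl w) = word_cocycle lam 1 0 w.
Proof.
rewrite /BStr; move: (pres_repr_class (BS_rels m n) w).
suff inv u v : pres_eq (BS_rels m n) u v ->
    word_cocycle lam 1 0 u = word_cocycle lam 1 0 v by exact: inv.
elim=> {u v w} // [v u w _ -> _ -> // | u u' v v' uu' eu _ ev | l | u v [-> ->]].
- have /pres_classP e := uu'.
  by rewrite !word_cocycle_cat // eu ev -!BSwt_cl e.
- exact: word_cocycle_cancel.
(* The relation a^-1 b^m a = b^n becomes lam^-1 m = n, which is [lam_mn]. *)
rewrite /BS_word_b !word_cocycle_cat // !word_wt_expb /= !word_cocycle_expb //.
rewrite /letter_cocycle /letter_wt /word_wt !big_cons !big_nil /= /letter_wt /=.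
rewrite expr0z !mulr0 oppr0 !addr0 add0r !mulr1 lam_mn.
by rewrite mulr0 addr0 mulrA mulVr // mul1r.
Qed.

Lemma BStrM g h : BStr (g * h)%g = BStr g + lam ^ BSwt g * BStr h.
Proof.
rewrite -[g]pres_reprK -[h]pres_reprK -[(_ * _)%g]BS_clM.
by rewrite !BStr_cl word_cocycle_cat // BSwt_cl.
Qed.

Lemma BStr1 : BStr 1%g = 0.
Proof.
apply: (addrI (BStr 1%g)).
by rewrite -{3}[1%g]mulg1 BStrM BSwt1 expr0z mul1r addr0.
Qed.

Lemma BStrV g : BStr g^-1%g = - (lam ^ (- BSwt g) * BStr g).
Proof.
apply: (addrI (lam ^ (- BSwt g) * BStr g)).
by rewrite subrr addrC -BSwtV -BStrM mulVg BStr1.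
Qed.

Lemma BStrX g k : BSwt g = 0 -> BStr (expgz g k) = BStr g * k%:~R.
Proof.
move=> g0; elim/int_rect: k => [|i IH|i IH]; first by rewrite BStr1 mulr0.
  rewrite -addn1 PoszD expgzD1 BStrM BSwtX g0 mul0r expr0z IH.
  by rewrite mul1r intrD mulrDr mulr1.
rewrite -addn1 PoszD opprD expgzB1 BStrM BSwtX g0 mul0r expr0z IH BStrV g0.
by rewrite oppr0 expr0z !mul1r intrD mulrDr mulrN1.
Qed.

Lemma BStr_a : BStr BSa = 0.
Proof. by rewrite BStr_cl /= /letter_cocycle /= mulr0 addr0. Qed.

Lemma BStr_b : BStr BSb = 1.
Proof. by rewrite BStr_cl /= /letter_cocycle /= mulr0 addr0. Qed.

End Translation.

(** * Effect of an endomorphism on the two cocycles *)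

Section Endomorphism.
Variable phi : UMagmaMorphism.type B B.
Hypothesis phib0 : BSwt (phi BSb) = 0.

Lemma BS_cons_cl l w :
  phi (cl (l :: w)) =
  ((if l.2 then (phi (pres_gen _ l.1 : B))^-1 else phi (pres_gen _ l.1)) *
    phi (cl w))%g.
Proof.
rewrite -cat1s BS_clM gmulfM; congr (_ * _)%g.
by case: l => x [] //=; rewrite -gmulfV [(_)^-1%g]pres_invE.
Qed.

Lemma BSwt_endo g : BSwt (phi g) = BSwt (phi BSa) * BSwt g.
Proof.
rewrite -[g]pres_reprK; elim: (pres_repr g) => [|l w IHw].
  by rewrite gmulf1 BSwt1 mulr0.
rewrite BS_cons_cl BSwtM IHw !BSwt_cl word_wt_cons mulrDr; congr (_ + _).
rewrite /letter_wt.
case: l => [[] []] /=; rewrite ?BSwtV -/BSa -/BSb ?phib0 ?oppr0; ring.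
Qed.

(** Pulled back along phi, [BStr lam] is a crossed homomorphism with multiplier mu; by
    [word_cocycle_wt0] its part coming from phi a dies on height 0. *)
Lemma BStr_endo (K : idomainType) (lam mu : K) g :
  mu = lam ^ BSwt (phi BSa) ->
  lam \is a GRing.unit -> m%:~R = lam * n%:~R -> m%:~R = mu * n%:~R ->
  BSwt g = 0 ->
  BStr lam (phi g) = BStr lam (phi BSb) * BStr mu g.
Proof.
move=> def_mu lam_unit lam_mn mu_mn.
have mu_unit : mu \is a GRing.unit by rewrite def_mu unitrXz.
rewrite -[g]pres_reprK BStr_cl // BSwt_cl.
move: (pres_repr g) => w w0.
transitivity (word_cocycle mu (BStr lam (phi BSb)) (BStr lam (phi BSa)) w).
  elim: w {w0} => [|l w IHw]; first by rewrite gmulf1 BStr1.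
  rewrite BS_cons_cl BStrM // IHw /= /letter_cocycle.
  case: l => [[] []] /=; rewrite -/BSa -/BSb ?BStrV // ?BSwtV /letter_wt /=;
    rewrite ?phib0 ?oppr0 //.
    by rewrite def_mu -invr_expz.
  by rewrite def_mu expr1z.
by rewrite word_cocycleD (word_cocycle_wt0 1 mu_unit w0) mulr0 addr0.
Qed.
End Endomorphism.

End BaumslagSolitar.

(** * The action on the Bass-Serre tree *)

Section Tree.
Variables m n : int.
Hypotheses (m_neq0 : m <> 0) (n_neq0 : n <> 0).
Notation B := (BS m n).
Notation cl := (pres_class (BS_rels m n)).

Definition modulus (e : bool) : int := if e then m else n.

(* A vertex of the tree is the path [:: (e1, r1); (e2, r2); ..] leading back to
   the base vertex, and (v, q) stands for the group element with normal form
   .. b^r2 a^e2 b^r1 a^e1 b^q, where a^true = a and a^false = a^-1. Then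
   [tree_step e] is right multiplication by a^e, which uses the relations
   b^(modulus e) a^e = a^e b^(modulus (~~ e)). *)
Definition tree_pt : Type := (seq (bool * int) * int)%type.

Definition tree_step (e : bool) (z : tree_pt) : tree_pt :=
  let r := (z.2 %% modulus e)%Z in
  let q := (z.2 %/ modulus e)%Z * modulus (~~ e) in
  let push := ((e, r) :: z.1, q) in
  if z.1 is (e', r') :: v then
    if (r == 0) && (e' != e) then (v, q + r') else push
  else push.

(** Normal forms of an HNN extension: residues are normalised, and a^-e is never followed by b^0
    a^e. *)
Fixpoint reduced_path (v : seq (bool * int)) : bool :=
  if v is (e, r) :: v' then
    [&& (r %% modulus e)%Z == r,
        (if v' is (e', _) :: _ then (r != 0) || (e' == e) else true)
      & reduced_path v']
  else true.

Lemma modulus_neq0 e : modulus e != 0.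
Proof. by case: e; apply/eqP. Qed.

Lemma tree_step_reduced e z : reduced_path z.1 -> reduced_path (tree_step e z).1.
Proof.
have modK q : ((q %% modulus e)%Z %% modulus e)%Z = (q %% modulus e)%Z.
  by rewrite modz_mod.
case: z => [[|[e' r'] v] q] /=; rewrite /= ?modK ?eqxx //.
rewrite /tree_step /= => red; case: ifP => [_|nc] /=; first by case/and3P: red.
by rewrite modK eqxx red andbT /=; move: nc; case: (_ == 0) => //= /negbFE.
Qed.

Lemma tree_stepK e z :
  reduced_path z.1 -> tree_step (~~ e) (tree_step e z) = z.
Proof.
have M0 := modulus_neq0.
have push v q : tree_step (~~ e) ((e, (q %% modulus e)%Z) :: v,
    (q %/ modulus e)%Z * modulus (~~ e)) = (v, q).
  rewrite /tree_step /= modzMl eqxx mulzK // negbK -addbN /=.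
  by case: (e) => /=; rewrite -divz_eq.
case: z => [[|[e' r'] v] q] /=; first by move=> _; exact: push.
rewrite {2}/tree_step /=.
case: ifP => [/andP[/eqP q0 e'e]|_ _]; last exact: push.
have -> : e' = ~~ e by case: (e) e' e'e => [] [].
(* After a pop, r' reappears as the remainder because it is normalised, and reducedness of the path
   forbids a second pop. *)
move=> /and3P[/eqP r'_mod r'_red _].
rewrite /tree_step /= negbK modzMDl r'_mod divzMDl // mulrDl.
have -> : (r' %/ modulus (~~ e))%Z = 0.
  apply/eqP; rewrite -[_ == 0]orFb -(negPf (M0 (~~ e))) orbC -mulf_eq0.
  by rewrite -(inj_eq (addIr (r' %% modulus (~~ e))%Z)) -divz_eq add0r r'_mod.
have qE : (q %/ modulus e)%Z * modulus e = q.
  by rewrite [RHS](divz_eq q (modulus e)) q0 addr0.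
rewrite mul0r addr0 qE.
case: v r'_red => [|[e2 r2] v] //=.
by case: (r' == 0) => /= [/eqP ->|_] //; rewrite eqxx.
Qed.

Definition tree_shift (k : int) (z : tree_pt) : tree_pt := (z.1, z.2 + k).

Lemma tree_step_shift e z :
  tree_step e (tree_shift (modulus e) z) =
  tree_shift (modulus (~~ e)) (tree_step e z).
Proof.
case: z => v q; rewrite /tree_step /tree_shift /= modzDr.
rewrite divzDr ?dvdzz // divzz modulus_neq0 mulrDl mul1r.
by case: v => [|[e' r'] v] //=; case: ifP => //= _; rewrite addrAC.
Qed.

Definition tree_letter (z : tree_pt) (l : bool * bool) : tree_pt :=
  if l.1 then tree_step (~~ l.2) z else tree_shift (if l.2 then -1 else 1) z.

Definition tree_act (w : word bool) (z : tree_pt) : tree_pt :=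
  foldl tree_letter z w.

Lemma tree_act_cat w w' z : tree_act (w ++ w') z = tree_act w' (tree_act w z).
Proof. exact: foldl_cat. Qed.

Lemma tree_act_reduced w z : reduced_path z.1 -> reduced_path (tree_act w z).1.
Proof.
elim: w z => [|[[] i] w IHw] z //= z_red; apply: IHw => //=.
exact: tree_step_reduced.
Qed.

Lemma tree_act_expb k z : tree_act (expw false k) z = tree_shift k z.
Proof.
have nseqb b i y : tree_act (nseq i (false, b)) y =
    tree_shift (if b then - i%:Z else i%:Z) y.
  elim: i y => [|i IHi] y /=.
    by case: b y => -[v q]; rewrite /tree_shift /= addr0.
  by rewrite IHi /tree_letter /tree_shift /=; case: b {IHi}; congr pair; lia.
by case: k => i; [exact: nseqb | rewrite NegzE; exact: (nseqb true i.+1)].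
Qed.

(** Cancellation of letters is [tree_stepK], and the defining relation is [tree_step_shift]; so path
    lengths are invariants of group elements. *)
Lemma tree_act_pres w w' z : pres_eq (BS_rels m n) w w' ->
  reduced_path z.1 -> tree_act w z = tree_act w' z.
Proof.
move=> ww'; elim: ww' z => {w w'} //.
- by move=> u v _ IH z /IH.
- by move=> v u w _ IH1 _ IH2 z z_red; rewrite IH1 // IH2.
- move=> u u' v v' _ IH1 _ IH2 z z_red; rewrite !tree_act_cat IH1 // IH2 //.
  exact: tree_act_reduced.
- move=> [[] i] [v q] z_red /=; rewrite /tree_letter /=.
    by rewrite tree_stepK.
  by rewrite /tree_shift /=; case: i; rewrite /= ?subrK ?addrK.
move=> u v [-> ->] z z_red; rewrite !tree_act_cat !tree_act_expb /=.
by rewrite /tree_letter /= (tree_step_shift true) (tree_stepK false).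
Qed.

Definition word_alen (w : word bool) : nat := count fst w.

Lemma size_tree_act w z :
  (size (tree_act w z).1 <= size z.1 + word_alen w)%N.
Proof.
elim: w z => [|[[] i] w IHw] z /=; first by rewrite addn0.
  apply: leq_trans (IHw _) _; rewrite addnA leq_add2r addn1.
  case: z => [[|[e r] v] q] //=; rewrite /tree_letter /tree_step /=.
  by case: ifP => //= _; lia.
exact: IHw.
Qed.

(** * Syllables, pinches and cyclic reduction *)

Definition syllable : Type := (int * bool)%type.

(** The syllable (i, e) stands for b^i a^e. *)
Definition syl_word (s : seq syllable) : word bool :=
  flatten [seq expw false p.1 ++ [:: (true, ~~ p.2)] | p <- s].

(** A pinch is a^e b^i a^-e with [modulus (~~ e)] dividing i; by the relation it equals a power of
    b. *)
Definition no_pinch (p p' : syllable) : bool :=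
  ~~ ((p'.2 == ~~ p.2) && (modulus p'.2 %| p'.1)%Z).

Definition tree_after (e : bool) (z : tree_pt) : bool :=
  (modulus (~~ e) %| z.2)%Z && (if z.1 is (e', _) :: _ then e' == e else false).

(** Britton's lemma on the tree: a step can pop only if its syllable forms a pinch with the previous
    one, so without pinches every syllable lengthens the path. *)
Lemma tree_act_syl p s z (z' := tree_act (syl_word s) z) :
  path no_pinch p s -> tree_after p.2 z ->
  tree_after (last p s).2 z' /\ size z'.1 = (size z.1 + size s)%N.
Proof.
rewrite {}/z'; elim: s p z => [|[i' e'] s IHs] [i e] z /=; first by rewrite addn0.
move=> /andP[np s_path] z_after.
rewrite /syl_word /= -catA -/(syl_word s) !tree_act_cat tree_act_expb /=.
rewrite /tree_letter /= negbK.
suff -> : tree_step e' (tree_shift i' z) =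
    ((e', ((z.2 + i') %% modulus e')%Z) :: z.1,
     ((z.2 + i') %/ modulus e')%Z * modulus (~~ e')).
  have [|-> ->] := IHs _ ((e', ((z.2 + i') %% modulus e')%Z) :: z.1,
     ((z.2 + i') %/ modulus e')%Z * modulus (~~ e')) s_path.
    by rewrite /tree_after /= dvdz_mull // eqxx.
  by rewrite /= addSnnS.
case: z z_after => [[|[e0 r] v] q]; rewrite /tree_after /= ?andbF // /tree_step /=.
move=> /andP[dvq /eqP ->].
have [e'e|e'e] := eqVneq e' e; first by rewrite andbF.
have e'N : e' = ~~ e by case: (e') (e) e'e => [] [].
move: np; rewrite /no_pinch /= e'N eqxx /= andbT => ndv.
case: ifP => // /eqP/dvdz_mod0P; rewrite rpredDl // => dv.
by rewrite dv in ndv.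
Qed.


(** Powers of a cyclically reduced word stay free of pinches, so each factor lengthens a suitable
    path by [size s], whereas a letter a of w adds at most one edge. *)
Lemma syl_pow_alen (s : seq syllable) w N :
  s != [::] -> cycle no_pinch s -> cl w = ((cl (syl_word s) : B) ^+ N)%g ->
  (N * size s <= word_alen w)%N.
Proof.
move=> s_neq0; rewrite (cycle_path (0, true)) => s_path clw.
set p := last _ s in s_path.
have p_last : last p s = p by rewrite /p; case: (s) s_neq0.
pose wN := flatten (nseq N (syl_word s)).
have clwN : cl wN = cl w.
  rewrite {}clw /wN; elim: N {wN} => [|N IHN] //=.
  by rewrite BS_clM IHN expgS.
have size_wN z : tree_after p.2 z ->
    size (tree_act wN z).1 = (size z.1 + N * size s)%N.
  rewrite /wN; elim: N {wN clw clwN} z => [|N IHN] z z_after /=.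
    by rewrite addn0.
  rewrite tree_act_cat; have [] := tree_act_syl s_path z_after.
  by rewrite p_last => /IHN -> ->; rewrite mulSn addnA.
(* A single edge in the direction of the last syllable of s makes even the first syllable push. *)
have := size_wN ([:: (p.2, 0)], 0).
rewrite /tree_after /= dvdz0 eqxx => /(_ isT).
rewrite (tree_act_pres (w' := w)) /= ?mod0z ?eqxx //; last exact/pres_classP.
move=> size_w; have := size_tree_act w ([:: (p.2, 0)], 0).
by rewrite size_w /= leq_add2l.
Qed.

Lemma word_alen_cat u v : word_alen (u ++ v) = (word_alen u + word_alen v)%N.
Proof. exact: count_cat. Qed.

Lemma word_alen_inv w : word_alen (invw w) = word_alen w.
Proof. by rewrite /word_alen /invw count_rev count_map. Qed.

Lemma word_alen_syl s : word_alen (syl_word s) = size s.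
Proof.
elim: s => [|[i e] s IHs] //.
rewrite /syl_word /= -catA !word_alen_cat -/(syl_word s) IHs.
have nseqb b k : word_alen (nseq k (false, b)) = 0 by elim: k.
by case: i => k; rewrite nseqb.
Qed.

Lemma BS_clV w : cl (invw w) = ((cl w : B)^-1)%g.
Proof.
apply: (mulIg (cl w : B)); rewrite mulVg -[LHS]BS_clM.
by apply/pres_classP; exact: pres_mulVw.
Qed.

Lemma word_alen_expgz w k : exists w',
  cl w' = expgz (cl w : B) k /\ word_alen w' = (`|k| * word_alen w)%N.
Proof.
have pow u i : cl (flatten (nseq i u)) = ((cl u : B) ^+ i)%g /\
    word_alen (flatten (nseq i u)) = (i * word_alen u)%N.
  elim: i => [|i [IH1 IH2]] //=; rewrite BS_clM word_alen_cat IH1 IH2.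
  by rewrite expgS mulSn.
case: k => i; first by exists (flatten (nseq i w)); exact: pow.
exists (flatten (nseq i.+1 (invw w))).
by have [-> ->] := pow (invw w) i.+1; rewrite word_alen_inv BS_clV expVgn.
Qed.

(** Conjugation by y costs a fixed number C of letters a; after raising the relation to the power C
    + 1, this cost is too small to make up for N > |k|. *)
Lemma syl_conj_bound s (y : B) (N : nat) k :
  s != [::] -> cycle no_pinch s ->
  expgz (cl (syl_word s) : B) N = (y^-1 * expgz (cl (syl_word s)) k * y)%g ->
  (N <= `|k|)%N.
Proof.
move=> s_neq0 s_cycle gN; set g := cl _ in gN.
rewrite leqNgt; apply/negP => ltkN.
pose C := (word_alen (pres_repr y) + word_alen (pres_repr y))%N.
have [w' [clw' lenw']] := word_alen_expgz (syl_word s) (k * C.+1%:Z).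
have := @syl_pow_alen s (invw (pres_repr y) ++ w' ++ pres_repr y) (N * C.+1).
rewrite !word_alen_cat word_alen_inv lenw' word_alen_syl abszM absz_nat.
have s_gt0 : (0 < size s)%N by case: (s) s_neq0.
move=> /(_ s_neq0 s_cycle) bound.
suff : (N * C.+1 * size s <= C + `|k| * C.+1 * size s)%N.
  apply/negP; rewrite -ltnNge.
  apply: (@leq_trans (`|k|.+1 * C.+1 * size s)); last by rewrite !leq_mul.
  by rewrite mulSn mulnDl ltn_add2r leq_pmulr.
apply: leq_trans (bound _) _; last by rewrite addnCA addnC.
rewrite !BS_clM BS_clV clw' pres_reprK mulgA expgzM -expgz_conj.
rewrite -[RHS]/(expgz (cl (syl_word s) : B) (N * C.+1)%N).
by rewrite PoszM expgzM gN !expgz_conj.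
Qed.

Lemma not_path_split (T : Type) (e : rel T) x q : ~~ path e x q ->
  exists q1 p p' q2, x :: q = q1 ++ p :: p' :: q2 /\ ~~ e p p'.
Proof.
elim: q x => [|y q IHq] x //=; rewrite negb_and => /orP[exy|/IHq].
  by exists [::], x, y, q.
by move=> [q1 [p [p' [q2 [-> epp']]]]]; exists (x :: q1), p, p', q2.
Qed.

(** A rotation moves the failing pair to the front; reflexivity excludes the cycle with one
    entry. *)
Lemma not_cycle_split (T : Type) (e : rel T) s :
  (forall x, e x x) -> ~~ cycle e s ->
  exists s1 s2 p p' s3, [/\ s = s1 ++ s2, s2 ++ s1 = p :: p' :: s3 & ~~ e p p'].
Proof.
move=> e_refl; case: s => [|x s] //= nc.
have [q1 [p [p' [q2 []]]]] := not_path_split nc.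
case/lastP: q2 => [|q2 y].
  rewrite -[q1 ++ _]/(q1 ++ [:: p] ++ [:: p']) catA !cats1 -rcons_cons.
  move=> /rcons_inj[+ xp']; rewrite -xp'.
  case: q1 => [[-> _]|x' q1 [-> ->]]; first by rewrite e_refl.
  by exists (x' :: q1), [:: p], p, x', q1; rewrite -cats1.
rewrite -!rcons_cons -rcons_cat => /rcons_inj[-> _] epp'.
by exists q1, (p :: p' :: q2), p, p', (q2 ++ q1).
Qed.

(** The elliptic elements, which fix a vertex of the tree. *)
Definition conj_b_pow (g : B) : Prop :=
  exists y r, g = (expgz (BSb m n) r ^ y)%g.

(** The hyperbolic elements, with translation length [size s]. *)
Definition conj_cyc_syl (g : B) : Prop :=
  exists y s,
    [/\ s != [::], cycle no_pinch s & g = ((cl (syl_word s) : B) ^ y)%g].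

Lemma conj_alt_conj g y : conj_b_pow g \/ conj_cyc_syl g ->
  conj_b_pow (g ^ y)%g \/ conj_cyc_syl (g ^ y)%g.
Proof.
case=> [[z [r ->]]|[z [s [? ? ->]]]].
  by left; exists (z * y)%g, r; rewrite conjgM.
by right; exists (z * y)%g, s; rewrite conjgM.
Qed.

Lemma syl_word_cat s s' : syl_word (s ++ s') = syl_word s ++ syl_word s'.
Proof. by rewrite /syl_word map_cat flatten_cat. Qed.

Definition BSae (e : bool) : B := if e then BSa m n else ((BSa m n)^-1)%g.

Lemma cl_syl_cons i e s :
  cl (syl_word ((i, e) :: s)) =
  (expgz (BSb m n) i * BSae e * (cl (syl_word s) : B))%g.
Proof.
rewrite /syl_word /= !BS_clM BS_clX; congr (_ * _ * _)%g.
by rewrite /BSae; case: e => //=; exact/esym/pres_invE.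
Qed.

Lemma BSae_pinch e q :
  (BSae e * expgz (BSb m n) (modulus (~~ e) * q) * BSae (~~ e))%g =
  expgz (BSb m n) (modulus e * q).
Proof.
rewrite !expgzM; case: e => /=; last by rewrite -BS_relation_expgz expgz_conj.
by rewrite -BS_relation_expgz expgz_conj !mulgA mulgV mul1g mulgK.
Qed.

(** Induction on the number of syllables: a rotation, which is a conjugation, brings a pinch to the
    front, and resolving it saves two syllables. *)
Lemma syl_conj_alt s :
  conj_b_pow (cl (syl_word s)) \/ conj_cyc_syl (cl (syl_word s)).
Proof.
have [N] := ubnP (size s); elim: N s => // N IHN s /ltnSE le_sN.
have [->|s_neq0] := eqVneq s [::]; first by left; exists 1%g, 0; rewrite conjg1.
have [s_cycle|] := boolP (cycle no_pinch s).
  by right; exists 1%g, s; rewrite conjg1.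
have np_refl : forall p, no_pinch p p by case=> i []; rewrite /no_pinch.
move=> /(not_cycle_split np_refl).
move=> [s1 [s2 [[i e] [[i' e'] [s3 [def_s def_s' pinch]]]]]].
have -> : cl (syl_word s) =
    ((cl (syl_word (s2 ++ s1)) : B) ^ (cl (syl_word s1))^-1)%g.
  by rewrite def_s !syl_word_cat !BS_clM conjgE invgK mulgK.
apply: conj_alt_conj; rewrite def_s'.
have sz_s3 : size s = (size s3).+2 by rewrite def_s size_cat addnC -size_cat def_s'.
move: pinch; rewrite /no_pinch negbK /= => /andP[/eqP -> /dvdzP[q ->]].
rewrite !cl_syl_cons mulrC -!mulgA [(_ * (_ * (_ * _)))%g in X in (_ * X)%g]mulgA.
rewrite [(_ * _ * (_ * _))%g]mulgA BSae_pinch.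
case: s3 sz_s3 {def_s'} => [|[i3 e3] s3] sz_s3.
  by left; exists 1%g, (i + modulus e * q); rewrite conjg1 mulg1 expgzD.
rewrite cl_syl_cons !mulgA -!expgzD -cl_syl_cons.
by apply: IHN; rewrite /= in sz_s3 *; lia.
Qed.

Lemma cl_syl_form w :
  exists s j, cl w = ((cl (syl_word s) : B) * expgz (BSb m n) j)%g.
Proof.
elim/last_ind: w => [|w [x i] [s [j clw]]]; first by exists [::], 0; rewrite mulg1.
rewrite -cats1 BS_clM clw; case: x => /=.
  exists (rcons s (j, ~~ i)), 0; rewrite mulg1 -cats1 syl_word_cat BS_clM.
  rewrite [cl (syl_word [:: _])]cl_syl_cons mulg1 -mulgA; congr (_ * (_ * _))%g.
  by rewrite /BSae; case: i => //=; exact/esym/pres_invE.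
exists s; case: i.
  by exists (j - 1); rewrite expgzB1 mulgA; congr (_ * _)%g; exact/esym/pres_invE.
by exists (j + 1); rewrite expgzD1 mulgA.
Qed.

(** Conjugation carries the trailing power of b to the front, where it merges with the first
    syllable. *)
Lemma BS_conj_alt g : conj_b_pow g \/ conj_cyc_syl g.
Proof.
rewrite -[g]pres_reprK; have [s [j ->]] := cl_syl_form (pres_repr g).
have -> : ((cl (syl_word s) : B) * expgz (BSb m n) j)%g =
    ((expgz (BSb m n) j * cl (syl_word s)) ^ (expgz (BSb m n) j))%g.
  by rewrite conjgE !mulgA mulVg mul1g.
apply: conj_alt_conj; case: s => [|[i e] s].
  by left; exists 1%g, j; rewrite conjg1 mulg1.
by rewrite cl_syl_cons !mulgA -expgzD -cl_syl_cons; exact: syl_conj_alt.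
Qed.

(* Otherwise x would be conjugate to a cyclically reduced g of positive length
   L; since g ^ N has length N * L, the given relation forces |m| = |n|. *)
Lemma BS_elliptic (x y : B) : `|m| <> `|n| ->
  (y^-1 * expgz x m * y)%g = expgz x n -> conj_b_pow x.
Proof.
move=> neq_mn rel; have [//|[h [s [s_neq0 s_cycle def_x]]]] := BS_conj_alt x.
set g : B := cl (syl_word s) in def_x.
have [y' relg] : exists y' : B, (y'^-1 * expgz g m * y')%g = expgz g n.
  exists (h * y * h^-1)%g.
  move: rel; rewrite def_x !conjgE !mulgA !expgz_conj.
  move=> /(congr1 (fun z => h * z * h^-1)%g).
  by rewrite !mulgA mulgK mulgV mul1g => <-; rewrite !invgM invgK !mulgA.
have relz k : (y'^-1 * expgz g (m * k) * y')%g = expgz g (n * k).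
  by rewrite !expgzM -relg expgz_conj.
(* The factor [sgz n] turns the exponent n into the natural number |n|, as [syl_conj_bound]
   requires. *)
have le_nm : (`|n| <= `|(m * sgz n)%R|)%N.
  apply: (@syl_conj_bound s y') => //.
  by rewrite -/g relz; congr expgz; lia.
have le_mn : (`|m| <= `|(n * sgz m)%R|)%N.
  apply: (@syl_conj_bound s y'^-1%g) => //.
  by rewrite -/g -relz invgK -!mulgA mulVKg mulgV mulg1; congr expgz; lia.
by exfalso; move: le_nm le_mn neq_mn; rewrite !abszM; lia.
Qed.

End Tree.

(** * Endomorphisms *)

Lemma int_mul_eq1 (k t : int) : k * t = 1 -> k = 1 \/ k = -1.
Proof.
move=> kt1; have : k \is a GRing.unit by apply/unitrPr; exists t.
by case/orP=> /eqP; [left | right].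
Qed.

Section Endomorphisms.
Variables m n : int.
Notation B := (BS m n).
Notation a := (BSa m n).
Notation b := (BSb m n).
Variable phi : UMagmaMorphism.type B B.

Lemma BS_endo_relation :
  ((phi a)^-1 * expgz (phi b) m * phi a)%g = expgz (phi b) n.
Proof. by rewrite -!gmulf_expgz -BS_relation_expgz !gmulfM gmulfV. Qed.

Lemma BSwt_phib : m <> n -> BSwt (phi b) = 0.
Proof.
move=> neq_mn; have /(congr1 (@BSwt m n)) := BS_endo_relation.
rewrite !BSwtM BSwtV !BSwtX => eq_wt; nia.
Qed.

Lemma BSwt_twisted x x' g : BSwt (phi b) = 0 ->
  x' = (g * x * (phi g)^-1)%g ->
  BSwt x' = BSwt x + (1 - BSwt (phi a)) * BSwt g.
Proof. by move=> phib0 ->; rewrite !BSwtM BSwtV (BSwt_endo phib0 g); ring. Qed.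

Lemma reidemeister_infinite_wt1 :
  BSwt (phi b) = 0 -> BSwt (phi a) = 1 -> reidemeister_infinite phi.
Proof.
move=> phib0 phia1.
apply: (@reidemeister_infinite_seq _ _ (fun i : nat => expgz a i)).
move=> i j [g /(BSwt_twisted phib0)].
by rewrite !BSwtX BSwt_a phia1 subrr mul0r addr0 !mul1r => -[].
Qed.

Lemma BSwt_phia_inj : m <> 0 -> n <> 0 -> `|m| <> `|n| -> injective phi ->
  BSwt (phi a) = 1.
Proof.
move=> m_neq0 n_neq0 neq_mn phi_inj.
have phib0 : BSwt (phi b) = 0 by apply: BSwt_phib => eq_mn; rewrite eq_mn in neq_mn.
have mQ : m%:~R != 0 :> rat by rewrite intr_eq0; apply/eqP.
have nQ : n%:~R != 0 :> rat by rewrite intr_eq0; apply/eqP.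
pose lam : rat := m%:~R / n%:~R.
have lam_neq0 : lam != 0 by rewrite mulf_neq0 ?invr_eq0.
have lam_unit : lam \is a GRing.unit by rewrite unitfE.
have lam_mn : m%:~R = lam * n%:~R by rewrite divfK.
have [h [r def_phib]] := BS_elliptic m_neq0 n_neq0 neq_mn BS_endo_relation.
have trb : BStr lam (phi b) != 0.
  (* The contributions of h and its inverse cancel, which leaves r times a power of lam. *)
  rewrite def_phib conjgE BStrM // BStrM // BStrV // BStrX ?BSwt_b //.
  rewrite BSwtX BSwt_b mul0r expr0z BStr_b // mul1r mul1r BSwtV.
  rewrite mulrDr addrCA addNr addr0.
  rewrite mulf_neq0 // ?expfz_neq0 // intr_eq0; apply/eqP => r0.
  have : phi b = phi 1%g by rewrite def_phib r0 conj1g gmulf1.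
  by move/phi_inj/(congr1 (BStr lam)); rewrite BStr_b // BStr1.
have /(congr1 (BStr lam)) := BS_endo_relation.
rewrite !BStrM // BStrV // !BStrX // BSwtM BSwtV BSwtX phib0 mul0r addr0.
set k := BSwt (phi a); rewrite addrAC addNr add0r mulrCA => /(mulfI trb) eq_k.
have lam_k : lam ^ (1 - k) = 1.
  apply: (mulIf nQ); rewrite mul1r -[RHS]eq_k lam_mn exprzDr // expr1z.
  by rewrite mulrCA mulrA.
(* As lam may be negative, its square is used: either the exponent vanishes or lam^2 = 1, and the
   latter means m^2 = n^2. *)
have : (lam * lam) ^ (1 - k) == 1 by rewrite expfzMl lam_k mulr1.
rewrite pexprz_eq1 -?expr2 ?sqr_ge0 // => /orP[|/eqP lam2].
  by rewrite subr_eq0 eq_sym => /eqP.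
suff : m ^+ 2 = n ^+ 2 by nia.
by apply/eqP; rewrite -(eqr_int rat) !rmorphXn /= lam_mn exprMn lam2 mul1r.
Qed.

Lemma BSwt_phia_bij : BSwt (phi b) = 0 -> bijective phi ->
  BSwt (phi a) = 1 \/ BSwt (phi a) = -1.
Proof.
move=> phib0 [psi _ psiK]; have := BSwt_endo phib0 (psi a).
by rewrite psiK BSwt_a => /esym/int_mul_eq1.
Qed.

(** * Automorphisms that reverse the height, for |m| = |n| *)

Section HeightReversing.
Hypotheses (phib0 : BSwt (phi b) = 0) (phiaN1 : BSwt (phi a) = -1).

Lemma BSwt0_preim g : BSwt (phi g) = 0 -> BSwt g = 0.
Proof. by rewrite (BSwt_endo phib0 g) phiaN1; lia. Qed.

Lemma BSwt_twisted0 x x' g : BSwt x = BSwt x' ->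
  x' = (g * x * (phi g)^-1)%g -> BSwt g = 0.
Proof. by move=> eq_wt /(BSwt_twisted phib0); rewrite phiaN1; lia. Qed.

Variable eps : int.
Hypotheses (eps_sq : eps * eps = 1) (eps_mn : m = eps * n).
Hypothesis phi_bij : bijective phi.

Let eps_unit : eps \is a GRing.unit.
Proof. by apply/unitrP; exists eps. Qed.

Let eps_int : m%:~R = eps * n%:~R.
Proof. by rewrite !intz. Qed.

Let epsV : eps ^ BSwt (phi a) = eps.
Proof. by rewrite phiaN1; apply: (mulIr eps_unit); rewrite mulVr // eps_sq. Qed.

(** As eps is its own inverse, the multiplier eps^-1 is again eps, and the same cocycle stands on
    both sides. *)
Lemma BStr_int_endo g : BSwt g = 0 ->
  BStr eps (phi g) = BStr eps (phi b) * BStr eps g.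
Proof. by move=> g0; apply: (BStr_endo phib0). Qed.

Lemma BStr_phib_bij : BStr eps (phi b) = 1 \/ BStr eps (phi b) = -1.
Proof.
case: phi_bij => psi _ psiK.
have psib0 : BSwt (psi b) = 0 by apply: BSwt0_preim; rewrite psiK BSwt_b.
by have := BStr_int_endo psib0; rewrite psiK BStr_b // => /esym/int_mul_eq1.
Qed.

(** The conjugator g has height 0, and the contributions of g and phi g to the cocycle cancel. *)
Lemma reidemeister_infinite_tr1 :
  BStr eps (phi b) = 1 -> reidemeister_infinite phi.
Proof.
move=> c1; apply: (@reidemeister_infinite_seq _ _ (fun i : nat => expgz b i)).
move=> i j [g eq_ij].
have g0 : BSwt g = 0 by apply: BSwt_twisted0 eq_ij; rewrite !BSwtX BSwt_b.
have phig0 : BSwt (phi g) = 0 by rewrite (BSwt_endo phib0 g) g0 mulr0.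
have /(congr1 (BStr eps)) := eq_ij.
rewrite !BStrM // BStrV // !BSwtM g0 phig0 !BStrX ?BSwtX ?BSwt_b //.
rewrite BStr_b // BStr_int_endo // c1 mul0r oppr0 addr0 !expr0z !mul1r !intz.
lia.
Qed.

(** The factor a in b^i a multiplies the contribution of phi g by eps = -1, which restores the
    cancellation. *)
Lemma reidemeister_infinite_epsN1 :
  BStr eps (phi b) = -1 -> eps = -1 -> reidemeister_infinite phi.
Proof.
move=> c1 epsN1.
apply: (@reidemeister_infinite_seq _ _ (fun i : nat => expgz b i * a)%g).
move=> i j [g eq_ij].
have g0 : BSwt g = 0.
  by apply: BSwt_twisted0 eq_ij; rewrite !BSwtM !BSwtX BSwt_b.
have phig0 : BSwt (phi g) = 0 by rewrite (BSwt_endo phib0 g) g0 mulr0.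
have /(congr1 (BStr eps)) := eq_ij.
rewrite !BStrM // BStrV // !BSwtM g0 phig0 !BStrX ?BSwtX ?BSwt_b //.
rewrite BStr_b // BStr_a // BSwt_a BStr_int_endo // c1.
rewrite !mul0r oppr0 !add0r !expr0z !expr1z !mul1r !intz epsN1; lia.
Qed.

End HeightReversing.
End Endomorphisms.

(** * The lamplighter quotient of B(m, m) *)

(** The cocycle is a Laurent polynomial in lam. One Q serves all K and lam, so values at X, 1/X and
    1 can be compared. *)
Lemma word_cocycle_poly (R : nzRingType) w : exists e (Q : {poly R}),
  forall (K : comUnitRingType) (f : {rmorphism R -> K}) (lam : K),
  lam \is a GRing.unit ->
  lam ^+ e * word_cocycle lam 1 0 w = (map_poly f Q).[lam].
Proof.
elim: w => [|l w [e [Q eQ]]].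
  by exists 0, 0 => K f lam _; rewrite rmorph0 horner0 /= mulr0.
case: l => [[] []].
- exists e.+1, Q => K f lam lam_unit; rewrite -eQ //= /letter_cocycle /=.
  rewrite mulr0 oppr0 add0r exprSr !mulrA; congr (_ * _).
  by rewrite -mulrA mulrV // mulr1.
- exists e, (Q * 'X) => K f lam lam_unit.
  rewrite rmorphM /= map_polyX hornerMX -eQ //= /letter_cocycle /letter_wt /=.
  by rewrite expr1z add0r mulrA mulrAC.
- exists e, (Q - 'X^e) => K f lam lam_unit.
  rewrite rmorphB /= map_polyXn hornerD hornerN hornerXn -eQ //=.
  by rewrite /letter_cocycle /letter_wt /= expr0z; ring.
exists e, (Q + 'X^e) => K f lam lam_unit.
rewrite rmorphD /= map_polyXn hornerD hornerXn -eQ //=.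
by rewrite /letter_cocycle /letter_wt /= expr0z; ring.
Qed.

(** * Laurent polynomials inside the field of rational functions *)

Section RationalFunctions.
Variable F : fieldType.
Notation FX := {fraction {poly F}}.
Notation ofF := (@FracField.tofrac {poly F} \o polyC).
Notation X := (FracField.tofrac 'X : FX).

Lemma fracX_neq0 : X != 0.
Proof. by rewrite tofrac_eq0 polyX_eq0. Qed.

Lemma fracX_unit : X \is a GRing.unit.
Proof. by rewrite unitfE fracX_neq0. Qed.

Lemma fracX_inj : injective (fun i : nat => X ^+ i).
Proof.
move=> i j /eqP; rewrite -!tofracXn tofrac_eq => /eqP.
move=> /(congr1 (fun P : {poly F} => size P)).
by rewrite !size_polyXn => -[].
Qed.

Lemma fracX_expz_eq1 k : X ^ k = 1 -> k = 0.
Proof.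
case: k => i; first by rewrite -(expr0 X) => /fracX_inj ->.
by rewrite NegzE -invr_expz => /eqP; rewrite invr_eq1 -(expr0 X) => /eqP/fracX_inj.
Qed.

Lemma fracX_horner Q : (map_poly ofF Q).[X] = FracField.tofrac Q.
Proof.
by rewrite map_poly_comp horner_map /= -[in RHS](comp_polyXr Q).
Qed.

Lemma fracXV_horner Q : exists N P,
  X ^+ N * (map_poly ofF Q).[X^-1] = FracField.tofrac P.
Proof.
elim/poly_ind: Q => [|Q c [N [P NP]]].
  by exists 0, 0; rewrite rmorph0 horner0 mulr0 tofrac0.
exists N.+1, (P + 'X^(N.+1) * c%:P).
rewrite rmorphD rmorphM /= map_polyX map_polyC /= hornerMXaddC mulrDr.
rewrite tofracD tofracM tofracXn -NP; congr (_ + _).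
by rewrite exprSr -!mulrA; congr (_ * _); rewrite mulrCA mulfV ?mulr1 ?fracX_neq0.
Qed.

(* Over a field the only invertible Laurent polynomials are the monomials. *)
Lemma word_cocycle_unit w w' :
  word_cocycle X 1 0 w * word_cocycle X^-1 1 0 w' = 1 ->
  word_cocycle X 1 0 w * word_cocycle X^-1 1 0 w =
  ofF (word_cocycle 1 1 0 w ^+ 2).
Proof.
have XV_unit : X^-1 \is a GRing.unit by rewrite unitrV fracX_unit.
have [e [Q eQ]] := word_cocycle_poly F w.
have [e' [Q' eQ']] := word_cocycle_poly F w'.
have [N [P NP]] := fracXV_horner Q'.
set u := word_cocycle X 1 0 w; set u' := word_cocycle X^-1 1 0 w' => uu'.
have uE : X ^+ e * u = FracField.tofrac Q.
  by rewrite (eQ _ ofF) ?fracX_unit // fracX_horner.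
have u'E : X ^+ N * u' = FracField.tofrac (P * 'X^e').
  rewrite tofracM -NP -(eQ' _ ofF) // tofracXn -!mulrA; congr (_ * _).
  by rewrite mulrCA -exprMn mulVf ?fracX_neq0 // expr1n mulr1.
(* Clearing denominators in u u' = 1 shows that Q divides a power of X, hence Q = c X^k. *)
have : Q %| 'X^(e + N).
  apply/dvdpP; exists (P * 'X^e'); apply/eqP.
  rewrite -tofrac_eq tofracM -u'E -uE mulrACA [u' * u]mulrC uu' mulr1.
  by rewrite -exprD addnC tofracXn.
rewrite -['X]subr0 -polyC0 => /dvdp_exp_XsubCP[k _ /eqpf_eq[c _]].
rewrite polyC0 subr0 => def_Q.
have QE (K : comUnitRingType) (f : {rmorphism F -> K}) (lam : K) :
    lam \is a GRing.unit -> lam ^+ e * word_cocycle lam 1 0 w = f c * lam ^+ k.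
  move=> lam_unit; rewrite (eQ _ f) // def_Q linearZ /= map_polyXn.
  by rewrite hornerZ hornerXn.
(* Evaluation at lam = 1 identifies the constant c. *)
have c1 := QE F idfun 1 (unitr1 _); rewrite !expr1n mul1r mulr1 /= in c1.
have Xe : X ^+ e * (X^-1) ^+ e = 1 by rewrite -exprMn mulfV ?fracX_neq0 ?expr1n.
have Xk : X ^+ k * (X^-1) ^+ k = 1 by rewrite -exprMn mulfV ?fracX_neq0 ?expr1n.
rewrite -[LHS]mul1r -{1}Xe mulrACA (QE _ ofF) ?fracX_unit // (QE _ ofF) //.
by rewrite mulrACA Xk mulr1 c1 expr2 rmorphM.
Qed.

End RationalFunctions.

(** Here h and h' will be the cocycles of the conjugator for X and 1/X; adding u times the second
    equation to the first eliminates both. *)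
Lemma twisted_pair_elim (K : comNzRingType) (u u' h h' x x' y y' : K) :
  u * u' = 1 -> x' = h + x - u * h' -> y' = h' + y - u' * h ->
  x' - x = u * (y - y').
Proof.
move=> uu' -> ->; transitivity (u * u' * h - u * h'); last by ring.
by rewrite uu'; ring.
Qed.

Section Lamplighter.
Variables (m : int) (p : nat).
Hypotheses (m_neq0 : m <> 0) (p_pr : prime p) (p_dvd : (p %| `|m|)%N).
Notation B := (BS m m).
Notation a := (BSa m m).
Notation b := (BSb m m).
Variable phi : UMagmaMorphism.type B B.
Hypothesis phi_bij : bijective phi.
Notation FX := {fraction {poly 'F_p}}.
Notation X := (FracField.tofrac 'X : FX).

Let mF : m%:~R = 0 :> 'F_p.
Proof. by apply/eqP; rewrite -(dvdz_pcharf (pchar_Fp p_pr)). Qed.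

(** As p divides m, the compatibility condition reads 0 = 0, so every unit lam gives a cocycle. *)
Let mFX (lam : FX) : m%:~R = lam * m%:~R.
Proof.
suff -> : m%:~R = 0 :> FX by rewrite mulr0.
by rewrite -(rmorph_int (@FracField.tofrac {poly 'F_p} \o polyC)) mF rmorph0.
Qed.

Let X_unit : X \is a GRing.unit := fracX_unit _.
Let XV_unit : X^-1 \is a GRing.unit.
Proof. by rewrite unitrV X_unit. Qed.

Lemma BSb_central (g : B) : commute (expgz b m) g.
Proof.
rewrite -[g]pres_reprK; elim: (pres_repr g) => [|l w IHw]; first exact: commute1.
rewrite -cat1s BS_clM; apply: commuteM => //.
have ca : commute (expgz b m) a.
  by apply: (mulgI a^-1%g); rewrite !mulgA BS_relation_expgz mulVg mul1g.
have cb : commute (expgz b m) b.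
  by rewrite /commute -expgzD1 addrC expgzD expgz1.
case: l => [[] []] //.
  by rewrite -[pres_class _ _]pres_invE; exact: commuteV.
by rewrite -[pres_class _ _]pres_invE; exact: commuteV.
Qed.

(* The image of b ^ m under phi is central in B(m, m), whereas the lamplighter
   group, in which a acts as multiplication by X, has trivial center. *)
Lemma BSwt_phib_eq : BSwt (phi b) = 0.
Proof.
case: phi_bij => psi _ psiK.
have := gmulf_commute phi (BSb_central (psi b)).
rewrite psiK gmulf_expgz => /(congr1 (BStr X)).
(* For z = (phi b)^m, comparing z b with b z gives X^(t z) = 1. *)
rewrite (BStrM X_unit (mFX X)) (BStrM X_unit (mFX X)).
rewrite (BStr_b X_unit (mFX X)) BSwt_b expr0z mul1r mulr1 addrC => /addIr.
move/fracX_expz_eq1/eqP; rewrite BSwtX mulf_eq0.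
by case/orP=> /eqP // /m_neq0.
Qed.

Lemma reidemeister_infinite_lamplighter :
  BSwt (phi a) = -1 -> BStr 1 (phi b) = -1 :> int -> reidemeister_infinite phi.
Proof.
move=> phiaN1 trb; have phib0 := BSwt_phib_eq.
pose u := BStr X (phi b); pose u' := BStr X^-1 (phi b).
have trX g : BSwt g = 0 -> BStr X (phi g) = u * BStr X^-1 g.
  have XN1 : X^-1 = X ^ BSwt (phi a) by rewrite phiaN1.
  exact: (BStr_endo phib0 XN1 X_unit (mFX _) (mFX _)).
have trXV g : BSwt g = 0 -> BStr X^-1 (phi g) = u' * BStr X g.
  have X1 : X = X^-1 ^ BSwt (phi a) by rewrite phiaN1 -exprz_inv invrK expr1z.
  exact: (BStr_endo phib0 X1 XV_unit (mFX _) (mFX _)).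
(* The preimage of b makes u invertible, hence a monomial; its coefficient is the value at lam = 1,
   namely -1 modulo p. *)
have uu' : u * u' = 1.
  case: phi_bij => psi _ psiK.
  have psib0 : BSwt (psi b) = 0.
    by apply: (BSwt0_preim phib0 phiaN1); rewrite psiK BSwt_b.
  have := trX _ psib0; rewrite psiK (BStr_b X_unit (mFX _)).
  move=> /esym/word_cocycle_unit.
  rewrite -/(BStr _ (phi b)) -/(BStr X^-1 (phi b)) -/u -/u' => ->.
  have -> : word_cocycle 1 1 0 (pres_repr (phi b)) =
      (BStr (1 : int) (phi b))%:~R :> 'F_p.
    rewrite /BStr (rmorph_word_cocycle (intmul (1 : 'F_p)) _ _ _ (unitr1 int)).
    by rewrite rmorph1 rmorph0.
  by rewrite trb rmorphN1 sqrrN expr1n rmorph1.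
pose f i : B := (expgz a i * b * expgz a (- i))%g.
have wt_f i : BSwt (f i) = 0 by rewrite /f !BSwtM !BSwtX BSwt_b BSwt_a; lia.
have tr_a (lam : FX) k : lam \is a GRing.unit -> BStr lam (expgz a k) = 0.
  move=> lam_u; elim/int_rect: k => [|i IH|i IH].
  - exact: BStr1 lam_u (mFX _).
  - rewrite -[i.+1]addn1 PoszD expgzD1 (BStrM lam_u (mFX _)) IH.
    by rewrite (BStr_a lam_u (mFX _)) mulr0 addr0.
  rewrite -[i.+1]addn1 PoszD opprD expgzB1 (BStrM lam_u (mFX _)) IH.
  rewrite (BStrV lam_u (mFX _)) (BStr_a lam_u (mFX _)).
  by rewrite mulr0 oppr0 mulr0 addr0.
have tr_f (lam : FX) i : lam \is a GRing.unit -> BStr lam (f i) = lam ^ i.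
  move=> lam_u; rewrite /f !(BStrM lam_u (mFX _)) !(tr_a _ _ lam_u).
  by rewrite (BStr_b lam_u (mFX _)) BSwtX BSwt_a mulr0 addr0 add0r mulr1 mul1r.
clearbody f; have twisted (i j : nat) :
    twisted_conj phi (f i) (f j) -> i = j \/ u = X ^+ (i + j).
  move=> [g eq_ij].
  have g0 : BSwt g = 0 by apply: (BSwt_twisted0 phib0 phiaN1) eq_ij; rewrite !wt_f.
  have phig0 : BSwt (phi g) = 0 by rewrite (BSwt_endo phib0 g) g0 mulr0.
  have tr_ij (lam : FX) : lam \is a GRing.unit ->
      lam ^+ j = BStr lam g + lam ^+ i - BStr lam (phi g).
    move=> lam_unit; have /(congr1 (BStr lam)) := eq_ij.
    rewrite !(BStrM lam_unit (mFX _)) (BStrV lam_unit (mFX _)).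
    rewrite !BSwtM g0 phig0 wt_f !(tr_f _ _ lam_unit).
    by rewrite oppr0 addr0 !expr0z !mul1r.
  have := tr_ij _ X_unit; have := tr_ij _ XV_unit.
  rewrite (trX _ g0) (trXV _ g0).
  set h := BStr X g; set h' := BStr X^-1 g => eqXV eqX.
  have eq_u : X ^+ j - X ^+ i = u * (X^-1 ^+ i - X^-1 ^+ j).
    exact: twisted_pair_elim uu' eqX eqXV.
  have [->|neq_ij] := eqVneq i j; [by left | right].
  have XX k : X ^+ k * X^-1 ^+ k = 1 by rewrite -exprMn mulfV ?fracX_neq0 ?expr1n.
  have D_neq0 : X ^+ j - X ^+ i != 0.
    by rewrite subr_eq0; apply: contraNneq neq_ij => /fracX_inj ->.
  apply: (mulIf D_neq0); rewrite {2}eq_u mulrCA; congr (u * _).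
  by rewrite exprD mulrBr -[_ * X^-1 ^+ j]mulrA XX mulr1 mulrAC XX mul1r.
(* If u = X^s, indices above s have sums above s and never collide; otherwise no pair collides. *)
have [[s def_u]|u_neq] := pselect (exists s : nat, u = X ^+ s).
  apply: (@reidemeister_infinite_seq _ _ (fun i : nat => f (s.+1 + i)%N)).
  move=> i j /twisted[/addnI //|]; rewrite def_u => /fracX_inj; lia.
apply: (@reidemeister_infinite_seq _ _ (fun i : nat => f i)).
by move=> i j /twisted[//|u_eq]; case: u_neq; exists (i + j)%N.
Qed.

End Lamplighter.

Theorem mainTheorem1 (m n : int) (m_neq0 : m <> 0) (n_neq0 : n <> 0) :
  (`|m| <> `|n| ->
     forall phi : UMagmaMorphism.type (BS m n) (BS m n),
       injective phi -> reidemeister_infinite phi) /\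
  (`|m| = `|n| -> m * n <> 1 ->
     forall phi : UMagmaMorphism.type (BS m n) (BS m n),
       bijective phi -> reidemeister_infinite phi).
Proof.
split=> [neq_mn phi phi_inj | eq_mn mn_neq1 phi phi_bij].
  apply: reidemeister_infinite_wt1; last exact: BSwt_phia_inj.
  by apply: BSwt_phib => eq_mn; rewrite eq_mn in neq_mn.
have [def_n|neq_mn] := eqVneq m n; last first.
  have mN : m = -1 * n by move/eqP: neq_mn; lia.
  have phib0 : BSwt (phi (BSb m n)) = 0 by apply: BSwt_phib; exact/eqP.
  have [|phiaN1] := BSwt_phia_bij phib0 phi_bij.
    exact: reidemeister_infinite_wt1.
  have [|c] := BStr_phib_bij phib0 phiaN1 (eps := -1) erefl mN phi_bij.
    exact: (reidemeister_infinite_tr1 phib0 phiaN1 (eps := -1)).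
  exact: (reidemeister_infinite_epsN1 phib0 phiaN1 (eps := -1)).
move: phi phi_bij; rewrite -def_n in mn_neq1 *.
move=> phi phi_bij {def_n eq_mn n_neq0 n}.
(* This provides the prime divisor p of m. *)
have m_gt1 : (1 < `|m|)%N.
  rewrite ltnNge; apply/negP => m_le1; apply: mn_neq1.
  by have [->|->] : m = 1 \/ m = -1 by lia.
have p_pr := pdiv_prime m_gt1; have p_dvd := pdiv_dvd `|m|%N.
have phib0 := BSwt_phib_eq m_neq0 p_pr p_dvd phi_bij.
have [|phiaN1] := BSwt_phia_bij phib0 phi_bij.
  exact: reidemeister_infinite_wt1.
have mE : m = 1 * m by rewrite mul1r.
have [|c] := BStr_phib_bij phib0 phiaN1 (eps := 1) erefl mE phi_bij.
  exact: (reidemeister_infinite_tr1 phib0 phiaN1 (eps := 1)).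
exact: (reidemeister_infinite_lamplighter m_neq0 p_pr p_dvd).
Qed.
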